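(* Let $\epsilon\ge0$, $\delta\ge0$, and let $\mathcal{D}$ be a set of quantum states with a symmetric neighbouring relation $\sim$. A quantum channel $\mathcal{A}$ is $(\epsilon,\delta)$-differentially private if and only if $$\mathcal{R}(\mathcal{A})\subseteq\mathcal{R}(\epsilon,\delta).$$
   Context: Hilbert spaces are finite-dimensional; a quantum channel is a completely positive trace-preserving map. $\mathcal{A}$ is $(\epsilon,\delta)$-differentially private if for all operators $0\le M\le I$ and all $\rho,\sigma\in\mathcal{D}$ with $\rho\sim\sigma$, $\operatorname{Tr}(M\mathcal{A}(\rho))\le e^\epsilon\operatorname{Tr}(M\mathcal{A}(\sigma))+\delta$. The privacy region $\mathcal{R}(\epsilon,\delta)$ is the set of pairs $(\alpha,\beta)$ (error probabilities in $[0,1]$) satisfying all four inequalities $$1-\alpha\le e^\epsilon\beta+\delta,\quad 1-\beta\le e^\epsilon\alpha+\delta,\quad \beta\le e^\epsilon(1-\alpha)+\delta,\quad \alpha\le e^\epsilon(1-\beta)+\delta.$$ The privacy region of $\mathcal{A}$ is $$\mathcal{R}(\mathcal{A})=\{(\operatorname{Tr}((I-M)\mathcal{A}(\rho)),\operatorname{Tr}(M\mathcal{A}(\sigma))):0\le M\le I,\ \rho,\sigma\in\mathcal{D},\ \rho\sim\sigma\}.$$ *)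

(* Defs.v *)
From mathcomp Require Import all_boot all_order all_algebra.
From mathcomp Require Import complex mxtens.
From mathcomp Require Import classical_sets reals sequences.

Set Implicit Arguments.
Unset Strict Implicit.
Unset Printing Implicit Defensive.

Import Order.TTheory GRing.Theory Num.Theory.

Local Open Scope ring_scope.
Local Open Scope complex_scope.
Local Open Scope classical_set_scope.

(* A finite-dimensional Hilbert space is C^n with C = R[i], and its operators
   are the matrices 'M[R[i]]_n. The order on R[i] is the partial one: x <= y
   iff y - x is a nonnegative real number. *)

(* <v, M v> >= 0 for every v. Over the complex numbers this already forces M
   to be Hermitian. *)
Definition psdmx (R : realType) (n : nat) (M : 'M[R[i]]_n) : Prop :=
  forall v : 'cV[R[i]]_n, 0 <= ((map_mx conjc v)^T *m M *m v) 0 0.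

Definition loewner_le (R : realType) (n : nat) (M N : 'M[R[i]]_n) : Prop :=
  psdmx (N - M).

Definition quantum_state (R : realType) (n : nat) (rho : 'M[R[i]]_n) : Prop :=
  psdmx rho /\ \tr rho = 1.

(* The operator (id_k (x) A) X on C^k (x) C^m, where X acts on C^k (x) C^n:
   the matrix of X consists of k x k blocks of size n, and A is applied to
   each block. *)
Definition ampliation (R : realType) (n m k : nat)
    (A : {linear 'M[R[i]]_n -> 'M[R[i]]_m})
    (X : 'M[R[i]]_(k * n)) : 'M[R[i]]_(k * m) :=
  \sum_(i < k) \sum_(j < k)
    delta_mx i j *t
      A (\matrix_(a, b) X (mxtens_index (i, a)) (mxtens_index (j, b))).

Definition completely_positive (R : realType) (n m : nat)
    (A : {linear 'M[R[i]]_n -> 'M[R[i]]_m}) : Prop :=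
  forall (k : nat) (X : 'M[R[i]]_(k * n)), psdmx X -> psdmx (ampliation A X).

Definition trace_preserving (R : realType) (n m : nat)
    (A : {linear 'M[R[i]]_n -> 'M[R[i]]_m}) : Prop :=
  forall X : 'M[R[i]]_n, \tr (A X) = \tr X.

Definition quantum_channel (R : realType) (n m : nat)
    (A : {linear 'M[R[i]]_n -> 'M[R[i]]_m}) : Prop :=
  completely_positive A /\ trace_preserving A.

Definition differentially_private (R : realType) (n m : nat)
    (D : set 'M[R[i]]_n) (nbr : 'M[R[i]]_n -> 'M[R[i]]_n -> Prop)
    (A : {linear 'M[R[i]]_n -> 'M[R[i]]_m}) (eps delta : R) : Prop :=
  forall (M : 'M[R[i]]_m) (rho sigma : 'M[R[i]]_n),
    loewner_le 0 M -> loewner_le M 1%:M ->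
    D rho -> D sigma -> nbr rho sigma ->
    \tr (M *m A rho) <= (expR eps)%:C * \tr (M *m A sigma) + delta%:C.

(* The pairs are typed in R[i] because traces are, but the bounds 0 <= _ <= 1
   make both components real. *)
Definition privacy_region (R : realType) (eps delta : R) :
    set (R[i] * R[i]) :=
  [set p | let: (alpha, beta) := p in
    [/\ 0 <= alpha <= 1, 0 <= beta <= 1 &
      [/\ 1 - alpha <= (expR eps)%:C * beta + delta%:C,
          1 - beta <= (expR eps)%:C * alpha + delta%:C,
          beta <= (expR eps)%:C * (1 - alpha) + delta%:C &
          alpha <= (expR eps)%:C * (1 - beta) + delta%:C]]].

Definition channel_privacy_region (R : realType) (n m : nat)
    (D : set 'M[R[i]]_n) (nbr : 'M[R[i]]_n -> 'M[R[i]]_n -> Prop)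
    (A : {linear 'M[R[i]]_n -> 'M[R[i]]_m}) : set (R[i] * R[i]) :=
  [set p | exists (M : 'M[R[i]]_m) (rho sigma : 'M[R[i]]_n),
    [/\ loewner_le 0 M /\ loewner_le M 1%:M,
        D rho, D sigma, nbr rho sigma &
        p = (\tr ((1%:M - M) *m A rho), \tr (M *m A sigma))]].

(* Main.v *)
Require Import Defs.
From mathcomp Require Import all_boot all_order all_algebra.
From mathcomp Require Import complex mxtens spectral ring.
From mathcomp Require Import classical_sets reals sequences.

Import Order.TTheory GRing.Theory Num.Theory.
Local Open Scope ring_scope.
Local Open Scope complex_scope.
Local Open Scope classical_set_scope.

(* The heart is that Tr (M N) >= 0 for positive semidefinite M and N, by
   diagonalizing N. As channels preserve positivity and trace, it puts the
   error probabilities in [0, 1]. The four inequalities of the privacy region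
   are then the privacy inequality for M and for I - M, each applied to
   (rho, sigma) and to (sigma, rho). *)

Lemma psdmx_congr {R : realType} {n p : nat} (B : 'M[R[i]]_(n, p))
    {M : 'M[R[i]]_n} :
  psdmx M -> psdmx ((map_mx conjc B)^T *m M *m B).
Proof.
move=> psdM v; have := psdM (B *m v).
by rewrite map_mxM trmx_mul !mulmxA.
Qed.

(** This is congruence by the 0/1 matrix whose column [j] is the basis vector of index [f j]. *)
Lemma psdmx_mxsub {R : realType} {n p : nat} (f : 'I_p -> 'I_n)
    {M : 'M[R[i]]_n} :
  psdmx M -> psdmx (mxsub f f M).
Proof.
move=> /(psdmx_congr (colsub f 1%:M)).
rewrite map_mxsub map_mx1 trmx_mxsub trmx1 -rowsubE mulmx_colsub mulmx1.
by congr psdmx; apply/matrixP => i j; rewrite !mxE.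
Qed.

Lemma psdmx_diag {R : realType} {n : nat} {M : 'M[R[i]]_n} (i : 'I_n) :
  psdmx M -> 0 <= M i i.
Proof.
move=> /(_ (delta_mx i 0)); rewrite map_delta_mx trmx_delta.
by rewrite -rowE -colE !mxE.
Qed.

(** By polarization, [s u w + s w u] is a combination of values of the quadratic form, hence real.
    The pairs (e_i, e_j) and (e_i, 'i e_j) determine the entries. *)
Lemma psdmx_hermitian {R : realType} {n : nat} {M : 'M[R[i]]_n} :
  psdmx M -> (map_mx conjc M)^T = M.
Proof.
move=> psdM.
pose s (u w : 'cV[R[i]]_n) : R[i] := ((map_mx conjc u)^T *m M *m w) 0 0.
have s_polar u w : s u w + s w u \is Num.real.
  have -> : s u w + s w u = s (u + w) (u + w) - s u u - s w w.
    rewrite /s map_mxD [(_ + _)^T]linearD !mulmxDl !mulmxDr.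
    move: (_ *m u) (_ *m w) (_ *m u) (_ *m w) => a b c d.
    by rewrite !mxE; ring.
  by rewrite !rpredB // ger0_real //; exact: psdM.
apply/matrixP => i j; rewrite !mxE.
have sE k l : s (delta_mx k 0) (delta_mx l 0) = M k l.
  by rewrite /s map_delta_mx trmx_delta -rowE -colE !mxE.
have sZr x a b : s a (x *: b) = x * s a b by rewrite /s -scalemxAr mxE.
have sZl x a b : s (x *: a) b = (x^*)%R * s a b.
  by rewrite /s map_mxZ [X in X *m M]linearZ /= -!scalemxAl mxE.
have /CrealP := s_polar (delta_mx i 0) ('i%R *: delta_mx j 0).
have /CrealP := s_polar (delta_mx i 0) (delta_mx j 0).
rewrite sZl sZr !sE conjCi !rmorphD !rmorphM rmorphN /= conjCi.
move: (M i j) (M j i) => x y xy_real ixy_real.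
(* Both [x + y] and ['i * (x - y)] are real; ['i] times the first plus the second is
   [2 * 'i * x]. *)
apply: (@mulfI _ (2 * 'i%R)); first by rewrite mulf_neq0 ?pnatr_eq0 ?neq0Ci.
transitivity ('i%R * ((x^*)%R + (y^*)%R) +
              (- 'i%R * (x^*)%R + - - 'i%R * (y^*)%R)); first by ring.
by rewrite xy_real ixy_real; ring.
Qed.

Lemma mxtrace_mulmx_ge0 {R : realType} {n : nat} {M N : 'M[R[i]]_n} :
  psdmx M -> psdmx N -> 0 <= \tr (M *m N).
Proof.
move=> psdM psdN.
have /orthomx_spectralP : N \is normalmx.
  by apply/normalmxP; rewrite -map_trmx (psdmx_hermitian psdN).
have P_unitary := spectral_unitarymx N.
rewrite (invmx_unitary P_unitary).
move: (spectralmx N) (spectral_diag N) P_unitary => P d P_unitary NE.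
(* Used twice: [B = N] gives the eigenvalues [d], [B = M] their weights in the trace. *)
have conj_diag_ge0 (B : 'M[R[i]]_n) i : psdmx B ->
    0 <= (P *m B *m map_mx Num.conj P^T) i i.
  move=> /(psdmx_congr (map_mx conjc P)^T) /(psdmx_diag i).
  rewrite map_trmx trmxK -map_mx_comp (eq_map_mx _ (@conjcK R)) map_mx_id //.
  by rewrite -map_trmx.
have d_ge0 i : 0 <= d 0 i.
  have := conj_diag_ge0 N i psdN.
  rewrite [in X in X -> _]NE !mulmxA (unitarymxP P_unitary) mul1mx.
  by rewrite mulmxtVK // mxE eqxx.
rewrite NE !mulmxA mxtrace_mulC !mulmxA mul_mx_diag.
by apply: sumr_ge0 => i _; rewrite mxE mulr_ge0 // conj_diag_ge0.
Qed.

(** This is complete positivity at [k = 1]; the index types ['I_(1 * n)] and ['I_n] are identified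
    by taking submatrices in both directions. *)
Lemma cp_psdmx {R : realType} {n m : nat}
    {A : {linear 'M[R[i]]_n -> 'M[R[i]]_m}} {X : 'M[R[i]]_n} :
  completely_positive A -> psdmx X -> psdmx (A X).
Proof.
move=> cpA psdX.
pose inner (k : nat) (a : 'I_(1 * k)) : 'I_k := (mxtens_unindex a).2.
have /cpA /(psdmx_mxsub (fun a => mxtens_index (0, a))) :=
  psdmx_mxsub (inner n) psdX.
congr psdmx; apply/matrixP => a b.
rewrite mxE /ampliation !big_ord1 tensmxE !mxE mul1r.
by congr ((A _) _ _); apply/matrixP => c d; rewrite !mxE /inner !mxtens_indexK.
Qed.

Theorem theoremV7 (R : realType) (n m : nat) (eps delta : R)
    (heps : 0 <= eps) (hdelta : 0 <= delta)
    (D : set 'M[R[i]]_n)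
    (hD : forall rho : 'M[R[i]]_n, D rho -> quantum_state rho)
    (nbr : 'M[R[i]]_n -> 'M[R[i]]_n -> Prop)
    (hsym : forall rho sigma : 'M[R[i]]_n,
      D rho -> D sigma -> nbr rho sigma -> nbr sigma rho)
    (A : {linear 'M[R[i]]_n -> 'M[R[i]]_m})
    (hA : quantum_channel A) :
  differentially_private D nbr A eps delta <->
  channel_privacy_region D nbr A `<=` privacy_region eps delta.
Proof.
have [cpA tpA] := hA.
have effectC (M : 'M[R[i]]_m) : loewner_le 0 M -> loewner_le M 1%:M ->
    loewner_le 0 (1%:M - M) /\ loewner_le (1%:M - M) 1%:M.
  by rewrite /loewner_le !subr0 subKr.
have trC (M : 'M[R[i]]_m) rho : D rho ->
    \tr ((1%:M - M) *m A rho) = 1 - \tr (M *m A rho).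
  by move=> /hD[_ tr1]; rewrite mulmxBl mul1mx raddfB /= tpA tr1.
have tr_ge0 (M : 'M[R[i]]_m) rho : loewner_le 0 M -> D rho ->
    0 <= \tr (M *m A rho).
  rewrite /loewner_le subr0 => psdM /hD[psd_rho _].
  exact: mxtrace_mulmx_ge0 psdM (cp_psdmx cpA psd_rho).
have tr01 (M : 'M[R[i]]_m) rho : loewner_le 0 M -> loewner_le M 1%:M ->
    D rho -> 0 <= \tr (M *m A rho) <= 1.
  (* The upper bound is nonnegativity of the trace for the complementary effect I - M. *)
  move=> M0 M1 Drho; have [C0 _] := effectC M M0 M1.
  by rewrite tr_ge0 //= -subr_ge0 -trC // tr_ge0.
split=> [dp _ [M [rho [sigma [[M0 M1] Drho Dsigma nbr_rs ->]]]] | sub].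
  have [C0 C1] := effectC M M0 M1.
  have nbr_sr := hsym _ _ Drho Dsigma nbr_rs.
  split; [exact: tr01 | exact: tr01 |].
  (* In order: [M] on (rho, sigma), I - M on (sigma, rho), [M] on (sigma, rho), I - M on (rho,
     sigma). *)
  split.
  - by rewrite trC // subKr; exact: dp.
  - by rewrite -trC //; exact: dp.
  - by rewrite trC // subKr; exact: dp.
  - by rewrite -trC //; exact: dp.
move=> M rho sigma M0 M1 Drho Dsigma nbr_rs.
(* At this point 1 - alpha = Tr(M A(rho)), so the first inequality of the region is the privacy
   inequality for [M]. *)
have [] := sub (\tr ((1%:M - M) *m A rho), \tr (M *m A sigma)).
  by exists M, rho, sigma.
by move=> _ _ []; rewrite trC // subKr.
Qed.
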